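(* Let $d \geq 3$ and $1 \leq r < \frac{d}{2}$ be integers, and let $\overline{B}_{d,r}(n)$ and $\overline{C}_{d,r}(n)$ be the numbers of overpartitions of $n$ defined in the context. Then, as formal power series in $q$ (equivalently, for $|q|<1$), $$\sum_{n\ge 0}\overline{C}_{d,r}(n)q^n = \left(\sum_{n\ge 0}\overline{B}_{d,r}(n)q^n\right) \cdot \left(1-q^d\right) g_2\left(-q^r; q^d\right),$$ where $g_2(x;q) := \sum_{n \geq 0} \frac{(-q; q)_n\, q^{n(n+1)/2}}{(x, q/x; q)_{n+1}}$.
   Context: Notation: for $n \in \mathbb{N}_0 \cup \{\infty\}$, $(a_1,\dots,a_k;q)_n := \prod_{j=0}^{n-1}(1-a_1q^j)\cdots(1-a_kq^j)$. An overpartition of $n$ is a partition of $n$ (a non-decreasing sequence of positive integer parts $\lambda_1 \le \lambda_2 \le \cdots$ with sum $n$) in which the final occurrence of each integer may be overlined. Use the four symbols $\overline{r}, \overline{d-r}, \overline{d}, d$ for types of parts: a part is said to be $\equiv \overline{r}$ (resp. $\overline{d-r}$, $\overline{d}$) modulo $d$ if it is overlined and its size is congruent to $r$ (resp. $d-r$, $d$) modulo $d$; it is $\equiv d$ modulo $d$ (without overline) if it is non-overlined and its size is divisible by $d$. The same convention (overlined symbol means overlined part, non-overlined symbol means non-overlined part) applies to congruences modulo $2d$. Define the matrix $\overline{A}_{d,r}$, with rows and columns both indexed in order by $\overline{r}, \overline{d-r}, \overline{d}, d$ and with $\overline{A}_{d,r}(u,v)$ the entry in row $u$, column $v$, by $$\overline{A}_{d,r}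 = \begin{pmatrix} d & 2r & d+r & r \\ 2d-2r & d & 2d-r & d-r \\ 2d-r & d+r & 2d & d \\ d-r & r & d & 0 \end{pmatrix}.$$ For $n \ge 0$, $\overline{B}_{d,r}(n)$ is the number of overpartitions $\lambda$ of $n$ into parts congruent to $r$, $d-r$, or $d$ modulo $d$, where only multiples of $d$ may appear non-overlined, such that: (i) the smallest part $\lambda_1$ is congruent to $\overline{r}$, $\overline{d-r}$, $\overline{d}$, or $2d$ modulo $2d$ (i.e. it is overlined with size congruent to $r$, $d-r$ or $d$ modulo $2d$, or non-overlined with size divisible by $2d$); (ii) for $u,v \in \{\overline{r},\overline{d-r},\overline{d},d\}$, if $\lambda_{i+1} \equiv u \pmod d$ and $\lambda_i \equiv v \pmod d$, then $\lambda_{i+1}-\lambda_i \geq \overline{A}_{d,r}(u,v)$; (iii) for $u,v$ as in (ii), if $\lambda_{i+1} \equiv u \pmod d$ and $\lambda_i \equiv v \pmod d$, then $\lambda_{i+1}-\lambda_i \equiv \overline{A}_{d,r}(u,v) \pmod{2d}$. $\overline{C}_{d,r}(n)$ is the number of overpartitions of $n$ into parts congruent to $r$, $d-r$, or $d$ modulo $d$, where only multiples of $d$ may appear non-overlined, satisfying (ii) and (iii), with (i) replaced by: all parts are larger than $d$ and the smallest part is congruent to $d$, $\overline{d+r}$, $\overline{2d-r}$ or $\overline{2d}$ modulo $2d$ (i.e. it is non-overlined with size congruent to $d$ modulo $2d$, or overlined with size congruent to $d+r$, $2d-r$ or $2d$ modulo $2d$). The empty overpartition is counted in both cases, so $\overline{B}_{d,r}(0)=\overline{C}_{d,r}(0)=1$.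 *)

(* Defs.v *)
From HB Require Import structures.
From mathcomp Require Import all_boot all_order all_algebra finmap.
From mathcomp Require Import boolp classical_sets functions cardinality.

Set Implicit Arguments.
Unset Strict Implicit.
Unset Printing Implicit Defensive.

Import GRing.Theory.
Local Open Scope ring_scope.

Record fps (R : Type) := Fps { fcoef :> nat -> R }.

Notation "{ 'fps' R }" := (fps R) (format "{ 'fps'  R }").

HB.instance Definition _ (R : Type) := gen_eqMixin (fps R).
HB.instance Definition _ (R : Type) := gen_choiceMixin (fps R).

Lemma fpsP (R : Type) (f g : {fps R}) : (forall n, f n = g n) <-> f = g.
Proof.
split=> [|-> //]; case: f => f; case: g => g /= fg.
by congr Fps; apply: funext.
Qed.

Section FpsRing.
Variable R : comNzRingType.
Implicit Types f g h : {fps R}.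

Definition fps_zero : {fps R} := Fps (fun=> 0).
Definition fps_one : {fps R} := Fps (fun n => (n == 0%N)%:R).
Definition fps_opp f : {fps R} := Fps (fun n => - f n).
Definition fps_add f g : {fps R} := Fps (fun n => f n + g n).
Definition fps_mul f g : {fps R} :=
  Fps (fun n => \sum_(i < n.+1) f i * g (n - i)%N).

Fact fps_addA : associative fps_add.
Proof. by move=> f g h; apply/fpsP => n /=; rewrite addrA. Qed.
Fact fps_addC : commutative fps_add.
Proof. by move=> f g; apply/fpsP => n /=; rewrite addrC. Qed.
Fact fps_add0 : left_id fps_zero fps_add.
Proof. by move=> f; apply/fpsP => n /=; rewrite add0r. Qed.
Fact fps_addN : left_inverse fps_zero fps_opp fps_add.
Proof. by move=> f; apply/fpsP => n /=; rewrite addNr. Qed.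

HB.instance Definition _ :=
  GRing.isZmodule.Build {fps R} fps_addA fps_addC fps_add0 fps_addN.

Definition fps_trunc N f : {poly R} := \poly_(i < N) f i.

Lemma fps_mul_trunc N f g n : (n < N)%N ->
  fps_mul f g n = (fps_trunc N f * fps_trunc N g)`_n.
Proof.
move=> nN; rewrite coefM /=; apply: eq_bigr => i _; rewrite !coef_poly.
by rewrite (leq_ltn_trans (leq_ord i) nN) (leq_ltn_trans (leq_subr _ _) nN).
Qed.

Fact fps_mulC : commutative fps_mul.
Proof.
by move=> f g; apply/fpsP => n; rewrite !(@fps_mul_trunc n.+1) // mulrC.
Qed.
Fact fps_mulA : associative fps_mul.
Proof.
move=> f g h; apply/fpsP => n.
have -> : fps_mul f (fps_mul g h) n =
    (fps_trunc n.+1 f * (fps_trunc n.+1 g * fps_trunc n.+1 h))`_n.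
  rewrite coefM /=; apply: eq_bigr => i _; rewrite coef_poly ltn_ord.
  by rewrite -(@fps_mul_trunc n.+1) // ltnS leq_subr.
rewrite mulrA coefM /=; apply: eq_bigr => i _.
rewrite coef_poly ltnS leq_subr.
by rewrite -(@fps_mul_trunc n.+1).
Qed.
Fact fps_mul1 : left_id fps_one fps_mul.
Proof.
move=> f; apply/fpsP => n /=.
by rewrite big_ord_recl /= mul1r subn0 big1 ?addr0 // => i _; rewrite mul0r.
Qed.
Fact fps_mulDl : left_distributive fps_mul fps_add.
Proof.
move=> f g h; apply/fpsP => n /=; rewrite -big_split /=.
by apply: eq_bigr => i _; rewrite mulrDl.
Qed.
Fact fps_oner_neq0 : fps_one != 0.
Proof. by apply/eqP => /fpsP /(_ 0%N) /= /eqP; rewrite oner_eq0. Qed.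

HB.instance Definition _ := GRing.Zmodule_isComNzRing.Build {fps R}
  fps_mulA fps_mulC fps_mul1 fps_mulDl fps_oner_neq0.

Definition fpsX : {fps R} := Fps (fun n => (n == 1%N)%:R).

(* Exact division: the h with h * g = f, or 0 if there is none.  Over a       *)
(* domain it is unique when g != 0 (divsE), and it exists when g 0 = 1        *)
(* (divs1P).  It also covers quotients such as X^d / X^r, r <= d, where the   *)
(* denominator is not a unit.                                                 *)
Definition divs f g : {fps R} := xget 0 [set h | h * g = f]%classic.

(* Sum in the X-adic topology: the coefficient of index m is the eventual     *)
(* value of the coefficients of index m of the partial sums.                  *)
Definition fpsum (u : nat -> {fps R}) : {fps R} :=
  Fps (fun m => xget 0
    [set c | exists N, forall n, (N <= n)%N -> (\sum_(i < n) u i) m = c]%classic).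

Lemma fpsumE (u : nat -> {fps R}) (m N : nat) (c : R) :
  (forall n, (N <= n)%N -> (\sum_(i < n) u i) m = c) -> fpsum u m = c.
Proof.
move=> uc /=; case: xgetP => [c' _ [M uc']|/(_ c)]; last by case; exists N.
by rewrite -(uc' _ (leq_maxr N M)) -(uc _ (leq_maxl N M)).
Qed.

End FpsRing.

Notation "f %/s g" := (divs f g) (at level 40, left associativity) : ring_scope.

Lemma divsE (R : idomainType) (f g h : {fps R}) :
  g != 0 -> h * g = f -> f %/s g = h.
Proof.
move=> g0 hg; rewrite /divs; case: xgetP => [h' _ /= h'g|/(_ h)]; last first.
  by case.
have: (h' - h) * g = 0 by rewrite mulrBl h'g hg subrr.
have exn (k : {fps R}) : k != 0 -> exists n, k n != 0.
  move=> k0; apply: contrapT => nex; case/negP: k0; apply/eqP/fpsP => n.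
  by apply: contrapT => /eqP kn; apply: nex; exists n.
case: (eqVneq (h' - h) 0) => [/subr0_eq //|].
move: (h' - h) => k /exn kn /fpsP kg.
case: (ex_minnP kn) (ex_minnP (exn _ g0)) => a ka mina [b gb minb].
have := kg (a + b)%N => /= /eqP.
have aP : (a < (a + b).+1)%N by rewrite ltnS leq_addr.
rewrite (bigD1 (Ordinal aP)) //= addKn big1 ?addr0 => [|i ia].
  by rewrite mulf_eq0 (negPf ka) (negPf gb).
case: (ltngtP i a) => [lt_ia|lt_ai|eq_ia].
- rewrite (_ : k i = 0) ?mul0r //.
  by apply/eqP; apply: contraTT lt_ia => /mina; rewrite -leqNgt.
- rewrite (_ : g _ = 0) ?mulr0 //.
  apply/eqP; apply: contraTT lt_ai => /minb; rewrite -leqNgt.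
  by rewrite leq_subRL ?(leq_ord i) // leq_add2r.
- by case/eqP: ia; apply: val_inj.
Qed.

Lemma divs1P (R : comNzRingType) (f g : {fps R}) :
  g 0%N = 1 -> (f %/s g) * g = f.
Proof.
move=> g0; rewrite /divs.
apply: (@xgetPex _ 0 [set h : {fps R} | h * g = f]%classic).
pose step s := rcons s (f (size s) - \sum_(i < size s) s`_i * g (size s - i)%N).
pose s n := iter n step [::].
have ss n : size (s n) = n by elim: n => //= n IH; rewrite size_rcons IH.
have sn i n : (i < n)%N -> (s n)`_i = (s i.+1)`_i.
  elim: n => // n IH; rewrite ltnS leq_eqVlt => /predU1P[-> //|lt_in].
  by rewrite [LHS]nth_rcons ss lt_in IH.
exists (Fps (fun n => (s n.+1)`_n)); apply/fpsP => n /=.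
rewrite big_ord_recr /= subnn g0 mulr1.
rewrite nth_rcons ss ltnn eqxx addrC.
pose F (i : 'I_n) := (s n)`_i * g (n - i)%N.
rewrite [X in _ + X](eq_bigr F) ?subrK // => i _; rewrite /F.
by rewrite (sn i n).
Qed.

(* [qpoch [:: a_1; ...; a_k] q n] is (a_1, ..., a_k; q)_n. *)
Definition qpoch (A : comNzRingType) (s : seq A) (q : A) (n : nat) : A :=
  \prod_(j < n) \prod_(a <- s) (1 - a * q ^+ j).

Definition g2 (R : comNzRingType) (x q : {fps R}) : {fps R} :=
  fpsum (fun n =>
    (qpoch [:: - q] q n * q ^+ (n * n.+1)./2)
      %/s qpoch [:: x; q %/s x] q n.+1).

Local Open Scope nat_scope.

(* The boolean tells whether the part is overlined. *)
Definition part := (nat * bool)%type.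

(* Overlining is allowed on the last occurrence of a size only. *)
Definition overpartition (n : nat) (l : seq part) : bool :=
  [&& all (fun p => 0 < p.1) l,
      pairwise (fun a b => (a.1 <= b.1) && ((a.1 == b.1) ==> ~~ a.2)) l
    & sumn [seq p.1 | p <- l] == n].

Lemma overpartition_finite n : finite_set [set l | overpartition n l]%classic.
Proof.
pose F (s : n.-bseq ('I_n.+1 * bool)) : seq part :=
  [seq (val p.1, p.2) | p <- s].
apply: (@sub_finite_set _ _ (F @` setT)%classic); last first.
  exact/finite_image/finite_finset.
move=> l /= /and3P[lpos _ /eqP ln].
have sz : size l <= n.
  rewrite -ln; elim: l lpos {ln} => //= p l IH /andP[p0 /IH {}IH].
  by rewrite -add1n leq_add.
have le_n p : p \in l -> p.1 <= n.
  rewrite -ln; elim: l {lpos ln sz} => //= a l IH.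
  rewrite inE => /predU1P[->|/IH pl]; first exact: leq_addr.
  exact: leq_trans pl (leq_addl _ _).
have szs : size [seq ((inord p.1 : 'I_n.+1), p.2) | p <- l] <= n.
  by rewrite size_map.
exists (Bseq szs) => //; rewrite /F /= -map_comp -[RHS]map_id.
apply/eq_in_map => -[a b] /le_n /= ab.
by rewrite inordK.
Qed.

Definition count_overpartitions (n : nat) (P : seq part -> Prop) : nat :=
  #|` fset_set [set l | overpartition n l /\ P l]%classic|%fset.

(* [over p a m] is p = \overline{a} mod m, and [plain p a m] is p = a mod m. *)
Definition over (p : part) (a m : nat) : bool := p.2 && (p.1 == a %[mod m]).
Definition plain (p : part) (a m : nat) : bool := ~~ p.2 && (p.1 == a %[mod m]).

(* The symbols \overline{r}, \overline{d-r}, \overline{d}, d. *)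
Inductive symb := Or | Odr | Od | Nd.

Definition has_type (d r : nat) (p : part) (u : symb) : bool :=
  match u with
  | Or => over p r d
  | Odr => over p (d - r) d
  | Od => over p d d
  | Nd => plain p d d
  end.

Definition Abar_row (a b c e : nat) (v : symb) : nat :=
  match v with Or => a | Odr => b | Od => c | Nd => e end.

Definition Abar (d r : nat) (u : symb) : symb -> nat :=
  match u with
  | Or  => Abar_row d               (2 * r) (d + r)     r
  | Odr => Abar_row (2 * d - 2 * r) d       (2 * d - r) (d - r)
  | Od  => Abar_row (2 * d - r)     (d + r) (2 * d)     d
  | Nd  => Abar_row (d - r)         r       d           0
  end.

(* Meant for overpartitions: parts being sorted, b.1 - a.1 is not truncated.  *)
(* The clause on types says that sizes are r, d-r or d modulo d and that only *)
(* multiples of d are non-overlined.                                          *)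
Definition admissible (d r : nat) (l : seq part) : Prop :=
  (forall p, p \in l -> exists u, has_type d r p u) /\
  forall i, i.+1 < size l ->
    let a := nth (0, false) l i in
    let b := nth (0, false) l i.+1 in
    forall u v, has_type d r b u -> has_type d r a v ->
      Abar d r u v <= b.1 - a.1 /\
      b.1 - a.1 = Abar d r u v %[mod 2 * d].

Definition smallest (P : part -> bool) (l : seq part) : bool :=
  if l is p :: _ then P p else true.

Definition Bbar_small (d r : nat) (p : part) : bool :=
  [|| over p r (2 * d), over p (d - r) (2 * d), over p d (2 * d)
    | plain p (2 * d) (2 * d)].

Definition Cbar_small (d r : nat) (p : part) : bool :=
  [|| plain p d (2 * d), over p (d + r) (2 * d), over p (2 * d - r) (2 * d)
    | over p (2 * d) (2 * d)].

Definition Bbar (d r n : nat) : nat :=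
  count_overpartitions n
    (fun l => admissible d r l /\ smallest (Bbar_small d r) l).

Definition Cbar (d r n : nat) : nat :=
  count_overpartitions n
    (fun l => [/\ admissible d r l, all (fun p => d < p.1) l
                & smallest (Cbar_small d r) l]).

Definition genfun (c : nat -> nat) : {fps int} := Fps (fun n => (c n)%:Z%R).

(* Main.v *)
(* Write Q = q^d, y = q^r and z = q^(d-r), so that y z = Q.  A part of type u *)
(* is d k + offset u, and Abar u v + offset v = offset u + d (gap v), so that *)
(* (ii) and (iii) say that the index k' of the part following a part (k, v)   *)
(* satisfies k' >= k + gap v and k' = k + gap v mod 2.  Let s_k be the        *)
(* generating function of the chains whose first index is >= k and of the     *)
(* same parity as k.  Then Bbar is s_0, and Cbar is (1 - Q) s_1 because       *)
(* non-overlined parts d are removed.  Sorting chains by their first part     *)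
(* gives                                                                      *)
(*   (1 - [k > 0] Q^k) s_k = (y + z) Q^k s_(k+1) + (1 + Q^(k+1)) s_(k+2),     *)
(* which, after multiplication by a product, is the second order recurrence   *)
(*   T_k = (y + z) Q^k T_(k+1) + (1 - Q^(2k+2)) T_(k+2).                      *)
(* Another solution is T_k = (-y Q^k, -z Q^k)_oo S_k with                     *)
(*   S_k = sum_n (Q^(2k); Q^2)_n Q^(n(n+1)/2) / ((Q)_n (-y Q^k, -z Q^k)_n)    *)
(* (a limiting 3phi2).  As k grows both solutions converge, hence they are    *)
(* proportional, and comparing them at k = 0, where S_0 = 1, and at k = 1,    *)
(* where S_1 = (1 + y) (1 + z) g2(-y; Q), gives the theorem.                  *)

Require Import Defs.
From mathcomp Require Import all_boot all_order all_algebra finmap.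
From mathcomp Require Import boolp classical_sets functions cardinality.
From mathcomp Require Import zify ring.
Set Implicit Arguments.
Unset Strict Implicit.
Unset Printing Implicit Defensive.
Import GRing.Theory.
Local Open Scope ring_scope.

(** Measured in units of d, the gap conditions concern only the indices of parts: by [AbarE] the
    type of the larger part cancels, leaving a lower bound and a parity ([mkpart_step]), and the
    smallest-part conditions of B and C become even and odd first index. Splitting off the first
    part ([chain_split], [opgf_chain]) gives a second-order recurrence for the series s_k, and
    [Bbar_chain] and [Cbar_chain] identify the two generating functions as s_0 and (1 - Q) s_1.
    Solved downwards from infinity, a convergent solution is determined by its limit ([rec_unique]).
    A second solution is explicit, the sum over n of [V k n]; it equals 1 at k = 0 ([T_0]) and g2 at
    k = 1 ([V_1]). Proportionality then yields s_1 = s_0 g2 ([rec_ratio]). *)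

(** * Power series modulo powers of X *)

Section FpsFacts.
Variable R : comNzRingType.
Implicit Types f g h : {fps R}.

Lemma coef_fps1 n : (1 : {fps R}) n = (n == 0%N)%:R. Proof. by []. Qed.
Lemma coef_fpsD f g n : (f + g) n = f n + g n. Proof. by []. Qed.
Lemma coef_fpsN f n : (- f) n = - f n. Proof. by []. Qed.
Lemma coef_fpsM f g n : (f * g) n = \sum_(i < n.+1) f i * g (n - i)%N.
Proof. by []. Qed.

Lemma coef0_fpsM f g : (f * g) 0%N = f 0%N * g 0%N.
Proof. by rewrite coef_fpsM big_ord1. Qed.

Lemma coef_fpsXnM f k n :
  (fpsX R ^+ k * f) n = if (k <= n)%N then f (n - k)%N else 0.
Proof.
elim: k n => [|k IH] n; first by rewrite expr0 mul1r subn0.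
rewrite exprS -mulrA; move: (_ * f) IH => g gE; rewrite coef_fpsM.
case: n => [|n].
  by rewrite big_ord1 /= mul0r.
rewrite (bigD1 (Ordinal (isT : (1 < n.+2)%N))) //= mul1r subn1 /= gE subSS ltnS.
by rewrite big1 ?addr0 // => i; rewrite -val_eqE /= => /negPf ->; rewrite mul0r.
Qed.

(** Divisibility by X^N; congruences modulo every X^N replace limits throughout. *)
Definition vanishes (N : nat) f := forall m, (m < N)%N -> f m = 0.

Lemma vanishesD N f g : vanishes N f -> vanishes N g -> vanishes N (f + g).
Proof. by move=> vf vg m mN; rewrite coef_fpsD vf ?vg ?addr0. Qed.

Lemma vanishesMl N f g : vanishes N g -> vanishes N (f * g).
Proof.
move=> vg m mN; rewrite coef_fpsM big1 // => i _.
by rewrite vg ?mulr0 // (leq_ltn_trans (leq_subr _ _)).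
Qed.

Lemma vanishesMr N f g : vanishes N f -> vanishes N (f * g).
Proof. by rewrite mulrC; apply: vanishesMl. Qed.

Lemma vanishesN N f : vanishes N f -> vanishes N (- f).
Proof. by move=> vf; rewrite -mulN1r; apply: vanishesMl. Qed.

Lemma vanishesB N f g : vanishes N f -> vanishes N g -> vanishes N (f - g).
Proof. by move=> vf vg; apply: vanishesD => //; apply: vanishesN. Qed.

Lemma vanishes_sum N (I : Type) (s : seq I) (P : pred I) (F : I -> {fps R}) :
  (forall i, P i -> vanishes N (F i)) -> vanishes N (\sum_(i <- s | P i) F i).
Proof. by move=> vF; apply: big_ind => //; apply: vanishesD. Qed.

Lemma vanishes_le N M f : (N <= M)%N -> vanishes M f -> vanishes N f.
Proof. by move=> NM vf m mN; apply: vf; apply: leq_trans NM. Qed.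

Lemma vanishesX f n : f 0%N = 0 -> vanishes n (f ^+ n).
Proof.
move=> f0; elim: n => [//|n IH] m; rewrite ltnS exprSr coef_fpsM => mn.
apply: big1 => i _; case: (ltnP i n) => [/IH ->|ni]; first by rewrite mul0r.
by rewrite (_ : (m - i)%N = 0%N) ?f0 ?mulr0 //; lia.
Qed.

Lemma vanishes_unit N (u : {fps R}) f :
  u 0%N = 1 -> vanishes N (f * u) -> vanishes N f.
Proof.
move=> u0 vfu; have <- : f * u * (1 %/s u) = f.
  by rewrite -mulrA [u * _]mulrC divs1P // mulr1.
exact: vanishesMr.
Qed.

Lemma vanishes_all f g : (forall N, vanishes N (f - g)) -> f = g.
Proof.
by move=> v; apply/fpsP => n; apply/eqP; rewrite -subr_eq0; apply/eqP/(v n.+1).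
Qed.

Lemma divs1E f g h : g 0%N = 1 -> h * g = f -> f %/s g = h.
Proof.
move=> g0 hg; have gi := divs1P 1 g0.
rewrite -[LHS]mulr1 -gi mulrCA divs1P // -hg mulrC -mulrA [g * _]mulrC.
by rewrite gi mulr1.
Qed.

Lemma fpsum_vanishes (u : nat -> {fps R}) N M :
  (forall n, vanishes n (u n)) -> (N <= M)%N ->
  vanishes N (fpsum u - \sum_(i < M) u i).
Proof.
move=> vu NM m mN; rewrite coef_fpsD coef_fpsN; apply/eqP; rewrite subr_eq0.
apply/eqP/(fpsumE (N := M)) => n Mn.
rewrite -!(big_mkord xpredT u) (big_cat_nat (leq0n M) Mn) //=.
rewrite (_ : (\sum_(M <= i < n) u i) m = 0) ?addr0 // big_seq_cond.
apply: (vanishes_sum (N := N)) => // i; rewrite mem_index_iota andbT.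
by case/andP=> Mi _; apply: vanishes_le (vu i); apply: leq_trans Mi.
Qed.

Lemma coef0_prod1 (I : Type) (s : seq I) (P : pred I) (F : I -> {fps R}) :
  (forall i, P i -> F i 0%N = 1) -> (\prod_(i <- s | P i) F i) 0%N = 1.
Proof.
apply: (big_ind (fun f : {fps R} => f 0%N = 1)) => // f g f1 g1.
by rewrite coef0_fpsM f1 g1 mulr1.
Qed.

Lemma coef0_qpoch (s : seq {fps R}) (Q : {fps R}) n :
  (forall a : {fps R}, a \in s -> a 0%N = 0) -> qpoch s Q n 0%N = 1.
Proof.
move=> s0; apply: coef0_prod1 => i _; rewrite big_seq.
apply: coef0_prod1 => a /s0 a0.
by rewrite coef_fpsD coef_fpsN coef0_fpsM a0 mul0r subr0.
Qed.

End FpsFacts.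

Lemma inverse_step (A : comNzRingType) (e f a b : A) :
  e * a = 1 -> f * (a * b) = 1 -> b * f = e.
Proof. by move=> ea fab; rewrite -[LHS]mul1r -ea -[RHS]mulr1 -fab; ring. Qed.

Lemma qpochSr (A : comNzRingType) (s : seq A) (q : A) n :
  qpoch s q n.+1 = qpoch s q n * \prod_(a <- s) (1 - a * q ^+ n).
Proof. by rewrite /qpoch big_ord_recr. Qed.

(** * The second-order recurrence and its explicit solution *)

Section SecondOrder.
Variables (R : comNzRingType) (Q y z : {fps R}).
Hypotheses (y0 : y 0%N = 0) (z0 : z 0%N = 0) (yz : y * z = Q).

Let Q0 : Q 0%N = 0.
Proof. by rewrite -yz coef0_fpsM y0 mul0r. Qed.

Let vanishesQ n : vanishes n (Q ^+ n). Proof. exact: vanishesX. Qed.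

Definition rec_defect (u : nat -> {fps R}) k :=
  u k - ((y + z) * Q ^+ k * u k.+1 + (1 - Q ^+ (2 * k.+1)) * u k.+2).

(* Solving the recurrence downwards, a solution is determined by its limit at *)
(* infinity; hence two convergent solutions are proportional.                 *)
Lemma rec_unique N (u v : nat -> {fps R}) :
    (forall k, vanishes N (rec_defect u k)) ->
    (forall k, vanishes N (rec_defect v k)) ->
    (forall k, vanishes k (u k.+1 - u k)) ->
    (forall k, vanishes k (v k.+1 - v k)) ->
  forall k, vanishes N (u N * v k - v N * u k).
Proof.
move=> ru rv lu lv k; set D := fun k => u N * v k - v N * u k.
suff vD : forall j i, (N <= i + j)%N -> vanishes N (D i).
  by apply: (vD N); apply: leq_addl.
(* [u N] and [v N] stand for the limits: from index N on both solutions are constant modulo X^N, and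
   [D N] is 0 by commutativity. *)
have vDN i : vanishes N (D (N + i)%N).
  elim: i => [|i IH]; first by rewrite addn0 /D mulrC subrr.
  rewrite (_ : D _ = D (N + i)%N + (u N * (v (N + i).+1 - v (N + i)%N)
      - v N * (u (N + i).+1 - u (N + i)%N))); last by rewrite /D addnS; ring.
  apply: vanishesD => //; apply: vanishesB; apply: vanishesMl;
    by apply: vanishes_le (leq_addr i N) _.
elim=> [|j IH] i Nij; first by rewrite -(@subnKC N i) // -[i]addn0.
case: (leqP N i) => [Ni|iN]; first by rewrite -(@subnKC N i).
rewrite (_ : D i = (y + z) * Q ^+ i * D i.+1
    + (1 - Q ^+ (2 * i.+1)) * D i.+2
    + (u N * rec_defect v i - v N * rec_defect u i)); last first.
  by rewrite /D /rec_defect; ring.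
apply: vanishesD; last by apply: vanishesB; apply: vanishesMl.
by apply: vanishesD; apply: vanishesMl; apply: IH; lia.
Qed.

(* Reciprocals of (Q)_n and (-y,-z)_n stand for the tails (Q^(n+1))_oo and    *)
(* (-yQ^n,-zQ^n)_oo: they obey the same recursion without infinite products.  *)
Let E n : {fps R} := 1 %/s qpoch [:: Q] Q n.
Let Y n : {fps R} := 1 %/s qpoch [:: - y; - z] Q n.
(** The shifted factorial (Q^(2k); Q^2)_n. *)
Let A k n : {fps R} := \prod_(j < n) (1 - Q ^+ (2 * (k + j))).

Let qE n : E n * qpoch [:: Q] Q n = 1.
Proof. by rewrite divs1P // coef0_qpoch // => a; rewrite inE => /eqP ->. Qed.

Let qY n : Y n * qpoch [:: - y; - z] Q n = 1.
Proof.
rewrite divs1P // coef0_qpoch // => a.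
by rewrite !inE => /predU1P[|/eqP] ->; rewrite coef_fpsN ?y0 ?z0 oppr0.
Qed.

Let ES n : E n = (1 - Q ^+ n.+1) * E n.+1.
Proof.
have := qE n; have := qE n.+1; rewrite qpochSr big_seq1 exprS => e1 e.
by rewrite -(inverse_step e e1); ring.
Qed.

Let YS n : Y n = (1 + (y + z) * Q ^+ n + Q ^+ (2 * n).+1) * Y n.+1.
Proof.
have := qY n; have := qY n.+1; rewrite qpochSr big_cons big_seq1 => e1 e.
have -> : Q ^+ (2 * n).+1 = y * z * Q ^+ n * Q ^+ n.
  by rewrite yz mul2n -addnn exprS exprD mulrA.
by rewrite -(inverse_step e e1); ring.
Qed.

Let AS k n : A k n.+1 = A k n * (1 - Q ^+ (2 * (k + n))).
Proof. by rewrite /A big_ord_recr. Qed.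

Let AS_shift k n : A k n.+1 = (1 - Q ^+ (2 * k)) * A k.+1 n.
Proof.
rewrite /A big_ord_recl addn0; congr (_ * _).
by apply: eq_bigr => i _; rewrite /= /bump addnS addSn.
Qed.

Let tri n := (n * n.+1)./2.

Let triS n : tri n.+1 = (tri n + n.+1)%N.
Proof. by rewrite /tri; have := odd_double_half (n * n.+1); lia. Qed.

Let triE n : (n <= tri n)%N.
Proof. by elim: n => // n; rewrite triS; lia. Qed.

(* The summand of the Q-hypergeometric solution: up to factors free of n, it  *)
(* is the n-th term of the series S_k of the header.                          *)
Let V k n : {fps R} := A k n * Q ^+ tri n * E n * Y (k + n)%N.

Let vanishesV k n : vanishes n (V k n).
Proof.
rewrite /V; do 2!apply: vanishesMr; apply: vanishesMl.
by apply: (vanishes_le (triE n)); apply: vanishesQ.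
Qed.

(* Found by creative telescoping: each V k i fails the recurrence, but the    *)
(* failures add up to a multiple of Q^(n(n+1)/2).                             *)
Let V_defect_sum k n :
  \sum_(i < n.+1) (V k i - ((y + z) * Q ^+ k * V k.+1 i
     + (1 - Q ^+ (2 * k.+1)) * V k.+2 i)) =
  A k.+1 n * Q ^+ tri n * E n *
    ((1 + Q ^+ (2 * k) * Q ^+ n.+1) * Y (k + n).+1
     - (1 - Q ^+ (2 * (k + n).+1)) * Y (k + n).+2).
Proof.
elim: n => [|n IH].
  rewrite big_ord1 /V /A !big_ord0 !addn0 (YS k).
  by rewrite !mul2n -!addnn !(exprS, exprD, expr0, addnS, addSn); ring.
(* All three products are brought back to [A k.+1 n]; after [ES] and [YS] the inductive step is a
   polynomial identity. *)
have a2 b e f : (1 - Q ^+ (2 * k.+1)) * (A k.+2 n.+1 * b * e * f) =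
    A k.+1 n * (1 - Q ^+ (2 * (k + n).+1)) * (1 - Q ^+ (2 * (k + n).+2))
      * b * e * f.
  by rewrite !mulrA -AS_shift 2!AS addnS !addSn.
rewrite big_ord_recr {}IH triS /= /V triS (ES n).
move: (tri n) => e; rewrite a2 !addSn !addnS (YS (k + n).+1) AS_shift AS.
by rewrite !mul2n -!addnn !(exprS, exprD, addnS, addSn); ring.
Qed.

Let T M k : {fps R} := \sum_(n < M) V k n.

Let T_defect N k : vanishes N (rec_defect (T N.+1) k).
Proof.
rewrite /rec_defect /T !mulr_sumr -big_split -sumrB /=.
rewrite V_defect_sum; do 2!apply: vanishesMr; apply: vanishesMl.
by apply: (vanishes_le (triE N)); apply: vanishesQ.
Qed.

Let vanishes_AB k n : vanishes k (A k.+1 n - A k n).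
Proof.
(* The last bracket is zero: both of its terms are [A k n.+1], with a factor split off at either end
   of the product. *)
rewrite (_ : _ - _ = Q ^+ k * (Q ^+ k * A k.+1 n - A k n * Q ^+ (k + 2 * n))
   + ((1 - Q ^+ (2 * k)) * A k.+1 n - A k n * (1 - Q ^+ (2 * (k + n))))).
  by rewrite -AS_shift AS subrr addr0; apply/vanishesMr/vanishesQ.
by rewrite !mul2n -!addnn !exprD; ring.
Qed.

Let T_step M k : vanishes k (T M k.+1 - T M k).
Proof.
rewrite /T -sumrB; apply: vanishes_sum => n _; rewrite /V.
rewrite (_ : _ - _ = (A k.+1 n - A k n) * (Q ^+ tri n * E n * Y (k.+1 + n))
   - Q ^+ k * (A k n * Q ^+ tri n * E n * Q ^+ n *
       (y + z + Q ^+ (k + n).+1) * Y (k.+1 + n))); last first.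
  rewrite (YS (k + n)) addSn mul2n -addnn.
  by rewrite !(exprS, exprD); ring.
apply: vanishesB; apply: vanishesMr; [exact: vanishes_AB | exact: vanishesQ].
Qed.

Let E_0 : E 0 = 1.
Proof. by have := qE 0; rewrite /qpoch big_ord0 mulr1. Qed.

Let Y_0 : Y 0 = 1.
Proof. by have := qY 0; rewrite /qpoch big_ord0 mulr1. Qed.

Let T_0 M : T M.+1 0 = 1.
Proof.
rewrite /T big_ord_recl big1 ?addr0 => [|i _]; rewrite /V /A.
  by rewrite big_ord0 [Q ^+ _]expr0 E_0 Y_0 !mul1r.
(* Every later term contains the factor 1 - Q^0 = 0. *)
by rewrite big_ord_recl expr0 subrr !mul0r.
Qed.

(** (Q^2; Q^2)_n = (Q)_n (-Q)_n, and (Q)_n cancels against [E n], which leaves the summand of g2. *)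
Let V_1 n :
  V 1 n = qpoch [:: - Q] Q n * Q ^+ tri n * (1 %/s qpoch [:: - y; - z] Q n.+1).
Proof.
rewrite /V add1n -/(Y n.+1) (_ : A 1 n = qpoch [:: Q] Q n * qpoch [:: - Q] Q n).
  by rewrite -[qpoch [:: - Q] Q n in RHS]mul1r -(qE n); ring.
rewrite /A /qpoch -big_split; apply: eq_bigr => i _ /=.
by rewrite !big_seq1 mul2n -addnn add1n !exprS exprD exprS; ring.
Qed.

Let coef0_T M k : T M.+1 k 0%N = 1.
Proof.
rewrite /T big_ord_recl coef_fpsD [X in _ + X](_ : _ = 0); last first.
  apply: (@vanishes_sum _ 1) => // i _.
  by apply: (@vanishes_le _ _ i.+1) => //; apply: vanishesV.
rewrite addr0 /V /A big_ord0 E_0 [Q ^+ _]expr0 !mul1r addn0.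
have := congr1 (fun f : {fps R} => f 0%N) (qY k).
rewrite coef0_fpsM coef0_qpoch ?mulr1 // => a.
by rewrite !inE => /predU1P[|/eqP] ->; rewrite coef_fpsN ?y0 ?z0 oppr0.
Qed.

Lemma rec_ratio (s : nat -> {fps R}) :
    s 0%N = (y + z) * s 1%N + (1 + Q) * s 2%N ->
    (forall k, (1 - Q ^+ k.+1) * s k.+1 =
       (y + z) * Q ^+ k.+1 * s k.+2 + (1 + Q ^+ k.+2) * s k.+3) ->
    (forall k, vanishes k (s k - 1)) ->
  s 1%N = s 0%N * fpsum (fun n => qpoch [:: - Q] Q n * Q ^+ (n * n.+1)./2
                           * (1 %/s qpoch [:: - y; - z] Q n.+1)).
Proof.
(* Dividing s_k by (Q)_(k-1) absorbs the factor 1 - Q^k on the left and turns 1 + Q^(k+1) into 1 -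
   Q^(2k+2). *)
move=> s0 sS s1; pose H k := if k is k'.+1 then E k' * s k else s 0%N.
have Hrec k : rec_defect H k = 0.
  rewrite /rec_defect /H; case: k => [|k].
    rewrite expr0 s0 E_0.
    have := ES 0; rewrite E_0 => e1.
    rewrite (_ : (1 - Q ^+ (2 * 1)) * (E 1 * s 2%N)
       = (1 + Q) * s 2%N * ((1 - Q ^+ 1) * E 1)); last by ring.
    by rewrite -e1; ring.
  rewrite (ES k).
  rewrite (_ : (1 - Q ^+ k.+1) * E k.+1 * s k.+1 =
     E k.+1 * ((1 - Q ^+ k.+1) * s k.+1)); last by ring.
  rewrite sS (ES k.+1) mul2n -addnn exprD; ring.
have Hlim k : vanishes k (H k.+1 - H k).
  case: k => [//|k]; rewrite /H.
  rewrite (_ : _ - _ = E k.+1 * (s k.+2 - 1) - E k * (s k.+1 - 1)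
     + Q ^+ k.+1 * E k.+1); last by rewrite (ES k); ring.
  apply: vanishesD; last exact/vanishesMr/vanishesQ.
  apply: vanishesB; apply: vanishesMl => //.
  exact: (vanishes_le _ (s1 k.+2)).
apply/esym/vanishes_all => N.
set g := fpsum _; have gT : vanishes N (g - T N.+1 1).
  rewrite /T; under eq_bigr do rewrite V_1.
  by apply: fpsum_vanishes => // n; rewrite -V_1.
have u k : vanishes N (T N.+1 N * H k - H N * T N.+1 k).
  by apply: rec_unique => // j; rewrite Hrec.
apply: (vanishes_unit (coef0_T N N)).
(* Proportionality at k = 0 and k = 1, combined so that the unknown [H N] drops out. *)
rewrite (_ : _ * _ = s 0%N * T N.+1 N * (g - T N.+1 1)
   - (T N.+1 N * H 1%N - H N * T N.+1 1)
   + T N.+1 1 * (T N.+1 N * H 0%N - H N * T N.+1 0)); last first.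
  by rewrite T_0 /H E_0; ring.
apply: vanishesD; last exact/vanishesMl/u.
by apply: vanishesB; [apply: vanishesMl | apply: u].
Qed.

End SecondOrder.

(** * Generating functions of classes of overpartitions *)

Section Counting.
Implicit Types (n : nat) (p : part) (l : seq part) (P : seq part -> Prop).

Definition opgf P : {fps int} := genfun (fun n => count_overpartitions n P).

Let cset n P := [set l | overpartition n l /\ P l]%classic.

Lemma finite_cset n P : finite_set (cset n P).
Proof. by apply: sub_finite_set (overpartition_finite n) => l []. Qed.

Lemma opgf_ext P1 P2 :
  (forall n l, overpartition n l -> P1 l <-> P2 l) -> opgf P1 = opgf P2.
Proof.
move=> e; apply/fpsP => n /=; congr (Posz _); rewrite /count_overpartitions.
congr (#|` fset_set _|)%fset; apply/seteqP.
by split=> l [ol Pl]; split=> //; apply/(e n).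
Qed.

Lemma opgfU P1 P2 : (forall l, P1 l -> P2 l -> False) ->
  opgf (fun l => P1 l \/ P2 l) = opgf P1 + opgf P2.
Proof.
move=> dis; apply/fpsP => n; rewrite coef_fpsD /= -PoszD.
congr (Posz _); rewrite /count_overpartitions.
rewrite (_ : [set l | _ /\ _]%classic = (cset n P1 `|` cset n P2)%classic).
  rewrite fset_setU; try exact: finite_cset.
  rewrite cardfsU (_ : (_ `&` _)%fset = fset0) ?cardfs0 ?subn0 //.
  apply/fsetP => l; rewrite in_fsetI !in_fset_set; try exact: finite_cset.
  apply/negbTE/negP => /andP[].
  by rewrite !inE => -[_ p1] [_ p2]; apply: dis p1 p2.
apply/seteqP; split=> l /=; first by case=> ol [] ?; [left|right].
by case=> -[ol ?]; split=> //; [left|right].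
Qed.

Lemma opgf_pred0 P : (forall n l, overpartition n l -> ~ P l) -> opgf P = 0.
Proof.
move=> nP; apply/fpsP => n /=; rewrite /count_overpartitions.
rewrite (_ : [set l | _ /\ _]%classic = set0) ?fset_set0 ?cardfs0 //.
by apply/seteqP; split=> // l [ol]; apply: nP ol.
Qed.

Definition cons_pred p P l := exists2 l', l = p :: l' & P l'.

Lemma overpartition_cons n p l :
  overpartition n (p :: l) =
  [&& 0 < p.1, p.1 <= n, overpartition (n - p.1) l
    & all (fun b => (p.1 <= b.1) && ((p.1 == b.1) ==> ~~ p.2)) l]%N.
Proof.
rewrite /overpartition /= -[LHS]andbA.
case: (0 < p.1)%N => //=; case: (all _ l) => /=; last first.
  by rewrite !andbF.
case: (pairwise _ l) => /=; rewrite ?andbF ?andbT //.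
by case: (all _ l) => /=; rewrite ?andbF ?andbT //; apply/eqP/andP; lia.
Qed.

Lemma opgf_cons p P : (0 < p.1)%N ->
    (forall n l, overpartition n l -> P l ->
       all (fun b => (p.1 <= b.1) && ((p.1 == b.1) ==> ~~ p.2))%N l) ->
  opgf (cons_pred p P) = fpsX int ^+ p.1 * opgf P.
Proof.
move=> p0 pP; apply/fpsP => n; rewrite coef_fpsXnM.
case: leqP => pn /=; last first.
  rewrite /count_overpartitions (_ : [set l | _ /\ _]%classic = set0).
    by rewrite fset_set0 cardfs0.
  apply/seteqP; split=> // l [] /[swap] -[l' -> _].
  by rewrite overpartition_cons => /and4P[_]; rewrite leqNgt pn.
congr (Posz _); rewrite /count_overpartitions.
rewrite (_ : [set l | _ /\ _]%classic = (cons p @` cset (n - p.1) P)%classic).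
  rewrite fset_set_image; last exact: finite_cset.
  by rewrite card_imfset //= => ? ? [].
apply/seteqP; split=> l /=.
  case=> /[swap] -[l' -> Pl']; rewrite overpartition_cons => /and4P[_ _ ol' _].
  by exists l'.
case=> l' [ol' Pl'] <-; split; last by exists l'.
by rewrite overpartition_cons p0 pn ol' (pP _ _ ol').
Qed.

End Counting.

(** * Gap conditions as chains of indices *)

Section Chains.
Variables (d r : nat).
Hypotheses (r0 : (0 < r)%N) (rd : (2 * r < d)%N).
Local Open Scope nat_scope.

(** The offsets are the column [Nd] of [Abar]. Hence an overlined multiple of d has offset d, and
    its index is one below its quotient by d. *)
Definition offset u :=
  match u with Or => r | Odr => d - r | Od => d | Nd => 0 end.
Definition gap u := match u with Or | Odr => 1 | Od => 2 | Nd => 0 end.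
Definition overlined u := if u is Nd then false else true.
Definition mkpart k u : part := (d * k + offset u, overlined u).

Lemma AbarE u v : Abar d r u v + offset v = offset u + d * gap v.
Proof. by case: u; case: v => /=; lia. Qed.

(** The part after [mkpart k u] is at least d (k + gap u), so chains are sorted, strictly after an
    overlined part, as overpartitions require. *)
Lemma offset_gap u : offset u <= d * gap u.
Proof. by case: u => /=; lia. Qed.

Lemma offset_gap_lt u : overlined u -> offset u < d * gap u.
Proof. by case: u => //= _; lia. Qed.

Lemma modn2d k x : x < d -> (d * k + x) %% (2 * d) = d * odd k + x.
Proof.
move=> xd; rewrite -{1}(odd_double_half k) mulnDr -addnA addnCA -mul2n mulnA.
rewrite [d * 2]mulnC -[_ * _ * k./2]mulnC modnMDl modn_small //.
by case: (odd k) => /=; lia.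
Qed.

Lemma mulDmod k x : x < d -> (d * k + x) %% d = x.
Proof. by move=> xd; rewrite [d * k]mulnC modnMDl modn_small. Qed.

Lemma has_type_mkpart k u v : has_type d r (mkpart k u) v <-> u = v.
Proof.
rewrite /has_type /Defs.over /plain /mkpart.
have [d0 ltr ltdr] : [/\ 0 < d, r < d & d - r < d] by split; lia.
have md : (d * k + d) %% d = 0 by rewrite -mulnSr modnMr.
have mo : (d * k + r) %% d = r by rewrite mulDmod.
have mdr : (d * k + (d - r)) %% d = d - r by rewrite mulDmod.
have m0 : (d * k + 0) %% d = 0 by rewrite mulDmod.
have sr : r %% d = r by rewrite modn_small.
have sdr : (d - r) %% d = d - r by rewrite modn_small.
split=> [|<-]; last by case: u; rewrite /= ?modnn ?md ?mo ?mdr ?m0 ?sr ?sdr.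
case: u; case: v => //=; rewrite ?modnn ?md ?mo ?mdr ?m0 ?sr ?sdr;
  by clear md mo mdr m0 sr sdr => /eqP; lia.
Qed.

Lemma has_type_ex p u : 0 < p.1 -> has_type d r p u ->
  exists k, p = mkpart k u.
Proof.
case: p => s o /= s0; have ds := divn_eq s d.
rewrite /has_type /Defs.over /plain /mkpart.
have [ltr ltdr] : r < d /\ d - r < d by split; clear ds; lia.
have sr : r %% d = r by rewrite modn_small.
have sdr : (d - r) %% d = d - r by rewrite modn_small.
case: u => /= /andP[]; case: o => //= _; rewrite ?modnn ?sr ?sdr => /eqP e;
  move: ds; rewrite e => ds.
- by exists (s %/ d); congr pair; rewrite mulnC.
- by exists (s %/ d); congr pair; rewrite mulnC.
(* Offset d lowers the index by one; positivity of the size keeps the quotient nonzero. *)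
- exists (s %/ d).-1; congr pair; rewrite -mulnSr prednK 1?mulnC; first lia.
  by case: (s %/ d) ds => //; lia.
- by exists (s %/ d); congr pair; rewrite mulnC.
Qed.

(** By [AbarE], the difference of sizes minus [Abar] is d (k' - (k + gap u)), which is a multiple of
    2d exactly when the parities agree. *)
Lemma mkpart_step k u k' u' :
  (mkpart k u).1 <= (mkpart k' u').1 ->
  (Abar d r u' u <= (mkpart k' u').1 - (mkpart k u).1 /\
   (mkpart k' u').1 - (mkpart k u).1 = Abar d r u' u %[mod 2 * d]) <->
  (k + gap u <= k' /\ odd k' = odd (k + gap u)).
Proof.
rewrite /mkpart /= => le; have AE := AbarE u' u.
have d0 : 0 < d by lia.
split=> [[leA /eqP eqA]|[lek eqk]].
  have lek : k + gap u <= k' by rewrite -(leq_pmul2l d0) mulnDr; lia.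
  split=> //; move: eqA; rewrite eqn_mod_dvd // /dvdn.
  rewrite (_ : _ - _ - _ = d * (k' - (k + gap u)) + 0); last first.
    by rewrite mulnBr mulnDr; lia.
  rewrite modn2d // addn0 muln_eq0 eqb0 => /orP[|]; first lia.
  by rewrite oddB //; case: odd; case: odd.
have ledk : d * (k + gap u) <= d * k' by rewrite leq_pmul2l.
have leA : Abar d r u' u <= d * k' + offset u' - (d * k + offset u).
  by move: ledk; rewrite mulnDr; lia.
split=> //; apply/eqP; rewrite eqn_mod_dvd // /dvdn.
rewrite (_ : _ - _ - _ = d * (k' - (k + gap u)) + 0); last first.
  by rewrite mulnBr mulnDr; lia.
by rewrite modn2d // oddB // eqk addbb muln0.
Qed.

(** By [mkpart_step], the next part depends on its predecessor only through k + gap u, so this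
    number is all that is carried along. *)
Fixpoint chain k (l : seq part) : Prop :=
  if l is p :: l' then
    exists k' u, [/\ k <= k', odd k' = odd k, p = mkpart k' u
                   & chain (k' + gap u) l']
  else True.

Lemma admissible_cons a l :
  admissible d r (a :: l) <->
  [/\ exists u, has_type d r a u, admissible d r l &
     if l is b :: _ then forall u v, has_type d r b u -> has_type d r a v ->
       Abar d r u v <= b.1 - a.1 /\ b.1 - a.1 = Abar d r u v %[mod 2 * d]
     else True].
Proof.
split=> [[ty st]|[tya [tyl stl] st]].
  split; first by apply: ty; rewrite mem_head.
    split=> [p pl|i]; first by apply: ty; rewrite inE pl orbT.
    by move=> il; apply: (st i.+1).
  by case: l ty st => // b l ty st; apply: (st 0).
split=> [p|[|i] il]; first by rewrite inE => /predU1P[->|/tyl].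
  by case: l il st {tyl stl}.
exact: stl.
Qed.

Lemma chain_admissible n k u l : overpartition n (mkpart k u :: l) ->
  admissible d r (mkpart k u :: l) <-> chain (k + gap u) l.
Proof.
elim: l n k u => [|b l IH] n k u ol.
  split=> // _; apply/admissible_cons; split=> //.
    by exists u; apply/has_type_mkpart.
move: ol; rewrite overpartition_cons => /and4P[_ _ ol /andP[/andP[leb _] _]].
have b0 : 0 < b.1 by move: ol; rewrite overpartition_cons => /andP[].
split.
  case/admissible_cons => _ adl st.
  have [[u' tu'] _ _] := (admissible_cons b l).1 adl.
  have [k' eb] := has_type_ex b0 tu'.
  move: ol adl st leb; rewrite eb => ol adl st leb.
  have [] := (mkpart_step leb).1 (st u' u _ _); try exact/has_type_mkpart.
  by move=> lek eqk; exists k', u'; split=> //; apply/(IH _ _ _ ol).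
case=> k' [u' [lek eqk eb ch]]; rewrite eb in ol leb *.
apply/admissible_cons; split; first by exists u; apply/has_type_mkpart.
  exact/(IH _ _ _ ol).
move=> w v /has_type_mkpart <- /has_type_mkpart <-.
exact/(mkpart_step leb).
Qed.

Lemma chain_ge k l : chain k l -> all (fun p : part => d * k <= p.1) l.
Proof.
elim: l k => //= p l IH k [k' [u [kk' _ -> /IH ch]]].
apply/andP; split=> /=.
  by rewrite (leq_trans _ (leq_addr _ _)) // leq_mul2l kk' orbT.
by apply: sub_all ch => q; apply: leq_trans; rewrite leq_mul2l; lia.
Qed.

(** By parity the first index is k or at least k + 2. The [Nd] case stands apart: its gap is 0, so
    it leads back to [chain k], and for k = 0 it would be a part of size 0. *)
Lemma chain_split k l :
  chain k l <->
  (chain k.+2 l \/ cons_pred (mkpart k Or) (chain k.+1) l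
   \/ cons_pred (mkpart k Odr) (chain k.+1) l
   \/ cons_pred (mkpart k Od) (chain k.+2) l)
  \/ cons_pred (mkpart k Nd) (chain k) l.
Proof.
case: l => [|p l]; first by split=> //= _; left; left.
split=> /=.
  case=> k' [u [kk' ok -> ch]].
  have [k2|k2] := leqP k.+2 k'.
    by left; left; exists k', u; split=> //=; rewrite negbK.
  have {kk' k2} ek : k' = k.
    have [//|k1] : k' = k \/ k' = k.+1 by lia.
    by move: ok; rewrite k1 /=; case: odd.
  move: ch; rewrite ek; case: u => /= ch.
  - by left; right; left; exists l; rewrite // -addn1.
  - by left; right; right; left; exists l; rewrite // -addn1.
  - by left; right; right; right; exists l; rewrite // -addn2.
  - by right; exists l; rewrite // -[k]addn0.
have cons1 u : cons_pred (mkpart k u) (chain (k + gap u)) (p :: l) ->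
    exists k' u', [/\ k <= k', odd k' = odd k, p = mkpart k' u'
                   & chain (k' + gap u') l].
  by case=> l' [-> ->] ch; exists k, u.
case=> [[|[|[|]]]|].
- by case=> k' [u [kk' ok -> ch]]; exists k', u; split=> //;
    [lia | rewrite ok /= negbK].
- by rewrite -addn1 => /(cons1 Or).
- by rewrite -addn1 => /(cons1 Odr).
- by rewrite -addn2 => /(cons1 Od).
- by rewrite -{2}[k]addn0 => /(cons1 Nd).
Qed.

Lemma mkpart_inj k : injective (mkpart k).
Proof.
move=> u v e; apply/(has_type_mkpart k u v); rewrite e.
exact/has_type_mkpart.
Qed.

Local Notation q := (fpsX int).
Local Notation G k := (opgf (chain k)).

Lemma opgf_cons_chain k u : 0 < (mkpart k u).1 ->
  opgf (cons_pred (mkpart k u) (chain (k + gap u))) =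
    (q ^+ (d * k + offset u) * G (k + gap u))%R.
Proof.
move=> pos; apply: opgf_cons => // n l _ /chain_ge; apply: sub_all => b /= le.
have lt := @offset_gap_lt u; move: le; rewrite mulnDr => le.
have := offset_gap u; case: (overlined u) lt => [/(_ isT)|_] lt; last first.
  by rewrite implybT andbT; lia.
by case: eqP => [|_]; rewrite ?andbT; lia.
Qed.

Lemma opgf_chain k :
  G k = (G k.+2 + q ^+ (d * k + r) * G k.+1 + q ^+ (d * k + (d - r)) * G k.+1
         + q ^+ (d * k + d) * G k.+2
         + (if k is 0 then 0 else q ^+ (d * k) * G k))%R.
Proof.
have dis u v (P P' : seq part -> Prop) l : u <> v ->
    cons_pred (mkpart k u) P l -> cons_pred (mkpart k v) P' l -> False.
  by move=> uv [l1 -> _] [l2 /(congr1 (head (0, false))) /mkpart_inj].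
have disc u (P : seq part -> Prop) l :
    chain k.+2 l -> cons_pred (mkpart k u) P l -> False.
  move=> /chain_ge /[swap] -[l' -> _] /= /andP[+ _].
  by rewrite -addn2 mulnDr; case: u => /=; lia.
rewrite [LHS](opgf_ext (fun n l _ => chain_split k l)).
rewrite opgfU => [|l [|[|[]]] h1 h2]; try by apply: dis h1 h2.
  rewrite opgfU => [|l h1 [|[]] h2]; try by apply: disc h1 h2.
  rewrite opgfU => [|l h1 [] h2]; try by apply: dis h1 h2.
  rewrite opgfU => [|l h1 h2]; try by apply: dis h1 h2.
  have := @opgf_cons_chain k Or; have := @opgf_cons_chain k Odr.
  have := @opgf_cons_chain k Od; rewrite /= addn1 addn2 => -> //; last lia.
  do 2!(move=> -> //; last lia).
  rewrite !addrA; congr (_ + _)%R; case: k {dis disc} => [|k].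
    (* [mkpart 0 Nd] has size 0, so no overpartition starts with it. *)
    apply: opgf_pred0 => n l /[swap] -[l' -> _].
    by rewrite overpartition_cons /= muln0.
  have := @opgf_cons_chain k.+1 Nd; rewrite /= !addn0 => -> //.
  by rewrite muln_gt0; lia.
by apply: disc h1 h2.
Qed.

(** Parts of a chain from k are at least dk, so below degree k only the empty one counts. *)
Lemma vanishes_opgf_chain k : vanishes k (G k - 1)%R.
Proof.
move=> m mk; rewrite coef_fpsD coef_fpsN coef_fps1 /=.
rewrite /count_overpartitions; case: m mk => [|m] mk.
  rewrite (_ : [set l | _ /\ _]%classic = [set [::]]%classic).
    by rewrite fset_set1 cardfs1 subrr.
  apply/seteqP; split=> l /=; last by move=> ->.
  by case=> + _; case: l => // p l; rewrite overpartition_cons; lia.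
rewrite (_ : [set l | _ /\ _]%classic = set0) ?fset_set0 ?cardfs0 ?subrr //.
apply/seteqP; split=> l //= [+ /chain_ge]; case: l => // p l.
by rewrite overpartition_cons => /and4P[_ pm _ _] /= /andP[]; nia.
Qed.

Lemma Bbar_small_mkpart k u : Bbar_small d r (mkpart k u) = ~~ odd k.
Proof.
have [d0 ltr ltdr] : [/\ 0 < d, r < d & d - r < d] by split; lia.
have md x : (d * k + d == x %[mod 2 * d]) = (d * ~~ odd k == x %% (2 * d)).
  by rewrite -mulnSr -[d * k.+1]addn0 modn2d // addn0.
rewrite /Bbar_small /Defs.over /plain /mkpart.
have [sr sdr] : r %% (2 * d) = r /\ (d - r) %% (2 * d) = d - r.
  by split; rewrite modn_small //; lia.
have sd : d %% (2 * d) = d by rewrite modn_small //; lia.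
have mr : (d * k + r) %% (2 * d) = d * odd k + r by rewrite modn2d.
have mdr : (d * k + (d - r)) %% (2 * d) = d * odd k + (d - r).
  by rewrite modn2d.
have m0 : (d * k + 0) %% (2 * d) = d * odd k + 0 by rewrite modn2d.
case: u => /=;
  rewrite ?mr ?mdr ?m0 ?md ?sr ?sdr ?sd ?modnn {mr mdr m0 md sr sdr sd};
  case: (odd k) => /=; rewrite ?muln1 ?muln0;
  by do 4?[case: eqP => [?|?] //=]; lia.
Qed.

Lemma Cbar_small_mkpart k u : Cbar_small d r (mkpart k u) = odd k.
Proof.
have [d0 ltr ltdr] : [/\ 0 < d, r < d & d - r < d] by split; lia.
have md x : (d * k + d == x %[mod 2 * d]) = (d * ~~ odd k == x %% (2 * d)).
  by rewrite -mulnSr -[d * k.+1]addn0 modn2d // addn0.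
rewrite /Cbar_small /Defs.over /plain /mkpart.
have sr : (d + r) %% (2 * d) = d + r by rewrite modn_small //; lia.
have sdr : (2 * d - r) %% (2 * d) = 2 * d - r by rewrite modn_small //; lia.
have sd : d %% (2 * d) = d by rewrite modn_small //; lia.
have mr : (d * k + r) %% (2 * d) = d * odd k + r by rewrite modn2d.
have mdr : (d * k + (d - r)) %% (2 * d) = d * odd k + (d - r).
  by rewrite modn2d.
have m0 : (d * k + 0) %% (2 * d) = d * odd k + 0 by rewrite modn2d.
case: u => /=;
  rewrite ?mr ?mdr ?m0 ?md ?sr ?sdr ?sd ?modnn {mr mdr m0 md sr sdr sd};
  case: (odd k) => /=; rewrite ?muln1 ?muln0;
  by do 4?[case: eqP => [?|?] //=]; lia.
Qed.

Lemma Bbar_chain n l : overpartition n l ->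
  admissible d r l /\ Defs.smallest (Bbar_small d r) l <-> chain 0 l.
Proof.
case: l => [|p l] ol; first by split=> // _; do !split.
have p0 : 0 < p.1 by move: ol; rewrite overpartition_cons => /andP[].
split=> [[ad]|] /=.
  have [[u tu] _ _] := (admissible_cons p l).1 ad.
  have [k ep] := has_type_ex p0 tu; rewrite ep Bbar_small_mkpart => /negPf ok.
  exists k, u; split=> //.
  by apply/(@chain_admissible n k u); rewrite -ep.
case=> k [u [_ ok ep ch]]; rewrite ep Bbar_small_mkpart ok; split=> //.
by apply/(@chain_admissible n k u); rewrite -?ep.
Qed.

(** The only part of odd index and size at most d is the plain d; chains starting with it are the
    ones that C forbids. *)
Lemma Cbar_chain n l : overpartition n l ->
  chain 1 l <->
  [/\ admissible d r l, all (fun p => d < p.1) l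
    & Defs.smallest (Cbar_small d r) l]
  \/ cons_pred (mkpart 1 Nd) (chain 1) l.
Proof.
case: l => [|p l] ol; first by split=> // _; left; do !split.
move: (ol); rewrite overpartition_cons => /and4P[p0 _ _ ple].
split=> [|[[ad _]|[l' [-> -> ch]]]] /=; last by exists 1, Nd.
  case=> k [u [k0 ok ep ch]]; have [dp|pd] := ltnP d p.1.
    left; split=> /=; last by rewrite ep Cbar_small_mkpart ok.
      by rewrite ep; apply/(@chain_admissible n k u); rewrite -?ep.
    apply: sub_all ple => b /andP[+ _]; exact: leq_trans.
  have k1 : k = 1 by move: pd; rewrite ep /=; nia.
  have uN : u = Nd by move: pd; rewrite ep k1; case: u {ep ch} => //=; lia.
  by right; exists l; [rewrite ep k1 uN | rewrite k1 uN in ch].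
have [[u tu] _ _] := (admissible_cons p l).1 ad.
have [k ep] := has_type_ex p0 tu; rewrite ep Cbar_small_mkpart => ok.
exists k, u; split=> //; first by case: k ok {ep}.
by apply/(@chain_admissible n k u); rewrite -ep.
Qed.

End Chains.

(** * Specialisation to Q = q^d, y = q^r, z = q^(d-r) *)

Theorem theorem1p3 (d r : nat) (hd : (3 <= d)%N) (hr1 : (1 <= r)%N)
    (hr2 : (2 * r < d)%N) :
  let q := fpsX int in
  genfun (Cbar d r) =
    genfun (Bbar d r) * ((1 - q ^+ d) * g2 (- q ^+ r) (q ^+ d)).
Proof.
move=> q; pose s k := opgf (chain d r k).
have sE k : s k = s k.+2 + q ^+ (d * k + r) * s k.+1
    + q ^+ (d * k + (d - r)) * s k.+1 + q ^+ (d * k + d) * s k.+2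
    + (if k is 0%N then 0 else q ^+ (d * k) * s k) := opgf_chain hr1 hr2 k.
have qX0 n : (0 < n)%N -> (q ^+ n) 0%N = 0 by apply: vanishesX.
have y0 : (q ^+ r) 0%N = 0 by apply: qX0.
have z0 : (q ^+ (d - r)) 0%N = 0 by apply: qX0; lia.
have yz : q ^+ r * q ^+ (d - r) = q ^+ d by rewrite -exprD subnKC //; lia.
have BE : genfun (Bbar d r) = s 0%N.
  by apply: opgf_ext => n l; apply: Bbar_chain.
have CE : genfun (Cbar d r) = (1 - q ^+ d) * s 1%N.
  have s1E : s 1%N = genfun (Cbar d r) + q ^+ d * s 1%N.
    rewrite {1}/s (opgf_ext (@Cbar_chain _ _ hr1 hr2)) opgfU.
      have := @opgf_cons_chain _ _ hr1 hr2 1 Nd.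
      by rewrite /= !addn0 muln1 => -> //; lia.
    by move=> l [_ + _] [l' el _]; rewrite el /= muln1 addn0 ltnn.
  by rewrite mulrBl mul1r {1}s1E addrK.
have g2E : g2 (- q ^+ r) (q ^+ d) = fpsum (fun n =>
    qpoch [:: - q ^+ d] (q ^+ d) n * (q ^+ d) ^+ (n * n.+1)./2
      * (1 %/s qpoch [:: - q ^+ r; - q ^+ (d - r)] (q ^+ d) n.+1)).
  rewrite /g2 (_ : q ^+ d %/s - q ^+ r = - q ^+ (d - r)); last first.
    (* The divisor is not a unit, so uniqueness of the quotient relies on the coefficients forming a
       domain. *)
    apply: divsE; last by rewrite mulrNN mulrC.
    apply/eqP => /(congr1 (fun f : {fps int} => f r)).
    by rewrite coef_fpsN -[q ^+ r]mulr1 coef_fpsXnM leqnn subnn.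
  congr fpsum; apply: funext => n.
  set g := qpoch [:: - q ^+ r; _] _ _.
  have g0 : g 0%N = 1.
    apply: coef0_qpoch => a; rewrite !inE => /predU1P[|/eqP] ->.
      by rewrite coef_fpsN y0 oppr0.
    by rewrite coef_fpsN z0 oppr0.
  by apply: divs1E => //; rewrite -!mulrA divs1P // mulr1.
rewrite BE CE g2E (rec_ratio y0 z0 yz (s := s)); first by ring.
- rewrite {1}sE muln0 !add0n addr0; ring.
- move=> k; have /eqP := sE k.+1; rewrite -subr_eq => /eqP sS.
  by rewrite mulrBl mul1r -!exprM sS !mulnS !exprD; ring.
- move=> k; apply: vanishes_opgf_chain; lia.
Qed.
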